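(* Let $\Phi=\sum_{n=1}^\infty\delta_{X_n}$ and $\Psi=\sum_{m=1}^\infty\delta_{Y_m}$ be point processes on $\mathbb{R}^d$ defined on $(\Omega,\mathcal{F},\mathbb{P})$, both simple, both compatible with the flow $\{\theta_t\}_{t\in\mathbb{R}^d}$ (which preserves $\mathbb{P}$), and with positive and finite intensities $\lambda_\Phi$ and $\lambda_\Psi$, respectively. Assume that a family of point processes $\Psi_n=\sum_{k=1}^{\kappa_n}\delta_{Y_{n,k}}$, $n\in\mathbb{N}$, on $\mathbb{R}^d$ can be constructed such that (1) the point processes $S_{-X_n}\Psi_n=\sum_{k=1}^{\kappa_n}\delta_{X_n+Y_{n,k}}$, $n\in\mathbb{N}$, form a partition of $\Psi$; that is, $\Psi=\sum_{n=1}^\infty S_{-X_n}\Psi_n$; (2) $\widetilde{\Phi}=\sum_{n=1}^\infty\delta_{(X_n,\Psi_n)}$ is a stationary marked point process (compatible with the flow $\{\theta_t\}_{t\in\mathbb{R}^d}$) with the set of counting measures on $\mathbb{R}^d$ as its mark space. Then, for any nonnegative random variable $W$ defined on $(\Omega,\mathcal{F})$, $$\lambda_\Psi\,\mathbb{E}_\Psi^0[W]=\lambda_\Phi\,\mathbb{E}_\Phi^0\biggl[\int_{\mathbb{R}^d}W\circ\theta_y\,\Psi_0(\mathrm{d}y)\biggr]=\lambda_\Phi\,\mathbb{E}_\Phi^0\Biggl[\sum_{k=1}^{\kappa_0}W\circ\theta_{Y_{0,k}}\Biggr],$$ where $\mathbb{E}_\Phi^0$ and $\mathbb{E}_\Psi^0$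 denote the expectations with respect to the Palm probabilities $\mathbb{P}_\Phi^0$ and $\mathbb{P}_\Psi^0$, and $\Psi_0=\sum_{k=1}^{\kappa_0}\delta_{Y_{0,k}}$ denotes the mark associated with the point $X_0=0$ on $\{\Phi(\{0\})=1\}$.
   Context: $(\Omega,\mathcal{F},\mathbb{P})$ is a probability space. $\mathbb{N}=\{1,2,\ldots\}$; $\delta_x$ is the Dirac measure at $x$; $\mathcal{B}(\mathbb{R}^d)$ is the Borel $\sigma$-field. Flow: $\{\theta_t\}_{t\in\mathbb{R}^d}$ is a family of $\mathcal{F}$-measurable bijections $\theta_t:\Omega\to\Omega$ with $\theta_t\circ\theta_u=\theta_{t+u}$ for $t,u\in\mathbb{R}^d$ and $\theta_0$ the identity, such that $(t,\omega)\mapsto\theta_t(\omega)$ is jointly measurable. It preserves $\mathbb{P}$: $\mathbb{P}\circ\theta_t^{-1}=\mathbb{P}$ for all $t\in\mathbb{R}^d$. Compatibility: a point process $\Phi=\sum_{n=1}^\infty\delta_{X_n}$ is compatible with the flow if $\Phi(\theta_t(\omega),B)=\Phi(\omega,B+t)$ for all $\omega\in\Omega$, $B\in\mathcal{B}(\mathbb{R}^d)$, $t\in\mathbb{R}^d$, where $B+t=\{x+t:x\in B\}$; that is, for every $t$ and $n$ there is $n'$ with $X_n\circ\theta_t=X_{n'}-t$. The marked point process $\widetilde\Phi=\sum_n\delta_{(X_n,\Psi_n)}$ is stationary in the sense of this framework: it is compatible with the flow in the sense that the marks travel with their points, i.e. when $X_n\circ\theta_t=X_{n'}-t$, one has $\Psi_n\circ\theta_t=\Psi_{n'}$.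 (In particular $\Psi_0\circ\theta_{X_n}=\Psi_n$, where $\Psi_0$ is the mark of the point at the origin.) Shift of measures: $S_t\eta(B)=\eta(B+t)$ for a measure $\eta$ on $\mathbb{R}^d$, $t\in\mathbb{R}^d$, $B\in\mathcal{B}(\mathbb{R}^d)$. Palm probability: for a simple compatible point process $\Phi$ with intensity $\lambda_\Phi\in(0,\infty)$, where $\lambda_\Phi=\mathbb{E}[\Phi([0,1]^d)]$, $\mathbb{P}_\Phi^0(A)=\lambda_\Phi^{-1}\,\mathbb{E}\bigl[\int_{[0,1]^d}\mathbf{1}_A\circ\theta_x\,\Phi(\mathrm{d}x)\bigr]$ for $A\in\mathcal{F}$; similarly for $\mathbb{P}_\Psi^0$. One has $\mathbb{P}_\Phi^0(\Phi(\{0\})=1)=\mathbb{P}_\Psi^0(\Psi(\{0\})=1)=1$. On the event $\{\Phi(\{0\})=1\}$ the index $0$ is assigned to the point at the origin, i.e. $X_0=0$, and $\Psi_0$ is its mark. *)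

(* Defs.v *)
From HB Require Import structures.
From mathcomp Require Import all_boot all_order all_algebra.
From mathcomp Require Import all_classical all_reals all_analysis.
From mathcomp Require Import measurable_realfun.

Set Implicit Arguments.
Unset Strict Implicit.
Unset Printing Implicit Defensive.

Import Order.TTheory GRing.Theory Num.Theory.
Import numFieldNormedType.Exports.

Local Open Scope classical_set_scope.
Local Open Scope ring_scope.

(* R^d is the normed space 'rV[R]_d, equipped with its Borel sigma-field.     *)
HB.instance Definition _ (R : realType) (d : nat) :=
  @isMeasurable.Build (sigma_display (@open 'rV[R]_d)) 'rV[R]_d
    <<s @open 'rV[R]_d >> (@sigma_algebra0 _ setT _) (@sigma_algebraC _ _)
    (@sigma_algebra_bigcup _ setT _).

Section space.
Context {R : realType} {d : nat}.
Local Notation Rd := 'rV[R]_d.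

Definition translate (B : set Rd) (t : Rd) : set Rd := [set x + t | x in B].

Definition shift_measure (t : Rd) (eta : set Rd -> \bar R) : set Rd -> \bar R :=
  fun B => eta (translate B t).

Definition unit_box : set Rd := [set x | forall i, 0 <= x ord0 i <= 1].

Lemma measurable_unit_box : measurable unit_box.
Proof.
rewrite -[unit_box]setCK; apply: measurableC.
apply: sub_sigma_algebra; apply: closed_openC.
have -> : unit_box =
    \bigcap_(i in [set: 'I_d]) ((fun x : Rd => x ord0 i) @^-1` `[0, 1]).
  apply/seteqP; split=> x /= h.
    by move=> i _ /=; rewrite in_itv /=; exact: h.
  by move=> i; have := h i Logic.I; rewrite /= in_itv.
apply: closed_bigI => i _; apply: preimage_closed; last exact: itv_closed.
by move=> x _; exact: coord_continuous.
Qed.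

(* A number of points in {0, 1, ..., oo} is an option nat, None standing for  *)
(* oo.  Points are numbered from 0, so [before k n] says that the k-th point  *)
(* exists.                                                                    *)
Definition before (k : nat) (n : option nat) : bool :=
  if n is Some m then (k < m)%N else true.

Definition atom (n : option nat) (y : nat -> Rd) (k : nat) :
    {measure set Rd -> \bar R} :=
  if before k n then (dirac (y k) : {measure set Rd -> \bar R}) else mzero.

Definition atoms (n : option nat) (y : nat -> Rd) : {measure set Rd -> \bar R} :=
  mseries (atom n y) 0.

End space.

Section flow.
Context {dO : measure_display} {Omega : measurableType dO} {R : realType}
  {d : nat}.
Local Notation Rd := 'rV[R]_d.

Record flow := Flow {
  theta :> Rd -> Omega -> Omega ;
  measurable_theta : forall t, measurable_fun setT (theta t) ;
  bijective_theta : forall t, bijective (theta t) ;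
  thetaD : forall t u, theta t \o theta u = theta (t + u) ;
  theta0 : theta 0 = id ;
  measurable_flow :
    measurable_fun setT (fun tw : Rd * Omega => theta tw.1 tw.2) }.

Definition preserves (th : flow) (P : set Omega -> \bar R) : Prop :=
  forall t A, measurable A -> pushforward P (th t) A = P A.

(* Measurability of the number of points is that of the events {k < npts}.    *)
(* The value of [pt k] outside of that event is irrelevant.                   *)
Record pointProcess := PointProcess {
  npts : Omega -> option nat ;
  pt : nat -> Omega -> Rd ;
  measurable_npts : forall k, measurable [set w | before k (npts w)] ;
  measurable_pt : forall k,
    measurable_fun [set w | before k (npts w)] (pt k) ;
  locally_finite : forall w (B : set Rd), measurable B -> bounded_set B ->
    (atoms (npts w) (pt ^~ w) B < +oo)%E }.

Definition pp_measure (Phi : pointProcess) (w : Omega) :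
    {measure set Rd -> \bar R} :=
  atoms (npts Phi w) (pt Phi ^~ w).
Coercion pp_measure : pointProcess >-> Funclass.

Definition simple (P : {measure set Omega -> \bar R}) (Phi : pointProcess) :
    Prop :=
  {ae P, forall w, forall x, (Phi w [set x] <= 1)%E}.

Definition compatible (th : flow) (Phi : pointProcess) : Prop :=
  forall w B t, measurable B -> Phi (th t w) B = Phi w (translate B t).

Definition compatible_marks (th : flow) (Phi : pointProcess)
    (mark : nat -> pointProcess) : Prop :=
  compatible th Phi /\
  forall t w n n', before n (npts Phi (th t w)) -> before n' (npts Phi w) ->
    pt Phi n (th t w) = pt Phi n' w - t ->
    forall B, measurable B -> mark n (th t w) B = mark n' w B.

(* The index of the point at the origin; irrelevant (and equal to 0) if there *)
(* is no such point.                                                          *)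
Definition origin_index (Phi : pointProcess) (w : Omega) : nat :=
  xget 0%N [set n | before n (npts Phi w) /\ pt Phi n w = 0].

Definition intensity (P : set Omega -> \bar R) (Phi : pointProcess) : \bar R :=
  (\int[P]_w Phi w unit_box)%E.

Definition palm (th : flow) (P : {measure set Omega -> \bar R})
    (Phi : pointProcess) (A : set Omega) : \bar R :=
  ((fine (intensity P Phi))^-1%:E *
   \int[P]_w \int[Phi w]_(x in unit_box) (\1_A (th x w))%:E)%E.

Section palm_measure.
Local Open Scope ereal_scope.
Variables (th : flow) (P : {measure set Omega -> \bar R}) (Phi : pointProcess).

Let point (k : nat) (w : Omega) : Rd :=
  if before k (npts Phi w) then pt Phi k w else 0%R.

Let measurable_point k : measurable_fun setT (point k).
Proof.
apply: measurable_fun_if => //.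
- by apply: (measurable_fun_bool true); rewrite setTI; exact: measurable_npts.
- by rewrite setTI; exact: measurable_pt.
Qed.

Let measurable_indic_flow A (y : Omega -> Rd) :
  measurable A -> measurable_fun setT y ->
  measurable_fun setT (fun w => \1_A (th (y w) w) : R).
Proof.
move=> mA my.
apply: (measurableT_comp (f := \1_A : Omega -> R)); first exact: measurable_indic.
apply: (measurableT_comp (measurable_flow th)
  (g := fun w => (y w, w) : Rd * Omega)).
exact: measurable_fun_pair.
Qed.

Let hit (k : nat) (A : set Omega) (w : Omega) : \bar R :=
  if before k (npts Phi w)
  then (\1_unit_box (pt Phi k w) * \1_A (th (pt Phi k w) w))%:E else 0.

Let hit_ge0 k A w : 0 <= hit k A w.
Proof. by rewrite /hit; case: ifP => // _; rewrite lee_fin mulr_ge0. Qed.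

Let palm_inner A w : measurable A ->
  \int[Phi w]_(x in unit_box) (\1_A (th x w))%:E = \sum_(k <oo) hit k A w.
Proof.
move=> mA.
have mf : measurable_fun unit_box (EFin \o (fun x : Rd => \1_A (th x w) : R)).
  apply/measurable_EFinP; apply: measurable_funTS.
  apply: (measurableT_comp (f := \1_A : Omega -> R)).
    exact: measurable_indic.
  apply: (measurableT_comp (measurable_flow th)
    (g := fun x => (x, w) : Rd * Omega)).
  exact: measurable_fun_pair.
have mB := @measurable_unit_box R d.
rewrite (ge0_integral_measure_series _ mB) //.
apply: eq_eseriesr => k _; rewrite /atom /hit; case: ifP => _.
  by rewrite integral_dirac// diracE EFinM indicE.
exact: integral_measure_zero.
Qed.

Let measurable_hit k A : measurable A -> measurable_fun setT (hit k A).
Proof.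
move=> mA.
have -> : hit k A = fun w => if before k (npts Phi w)
    then (\1_unit_box (point k w) * \1_A (th (point k w) w))%:E else 0.
  by apply/funext => w; rewrite /hit /point; case: ifP.
apply: measurable_fun_ifT => //.
  by apply: (measurable_fun_bool true); rewrite setTI; exact: measurable_npts.
apply/measurable_EFinP; apply: measurable_funM; last exact: measurable_indic_flow.
apply: (measurableT_comp (f := \1_unit_box : Rd -> R)) => //.
by apply: measurable_indic; exact: measurable_unit_box.
Qed.

Let palm0 : palm th P Phi set0 = 0.
Proof.
rewrite /palm integral0_eq ?mule0// => w _; rewrite integral0_eq// => x _.
by rewrite indic0.
Qed.

Let intensity_ge0 : 0 <= intensity P Phi.
Proof. by apply: integral_ge0. Qed.

Let palm_ge0 A : 0 <= palm th P Phi A.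
Proof.
apply: mule_ge0; first by rewrite lee_fin invr_ge0 fine_ge0.
apply: integral_ge0 => w _; apply: integral_ge0 => x _.
by rewrite lee_fin.
Qed.

Let palm_sigma_additive : semi_sigma_additive (palm th P Phi).
Proof.
move=> F mF tF mUF.
have c0 : (0 <= (fine (intensity P Phi))^-1)%R by rewrite invr_ge0 fine_ge0.
have palmE A : measurable A -> palm th P Phi A =
    (fine (intensity P Phi))^-1%:E * \sum_(k <oo) \int[P]_w hit k A w.
  move=> mA; rewrite /palm; congr *%E.
  rewrite -integral_nneseries//; last by move=> k; exact: measurable_hit.
  by apply: eq_integral => w _; exact: palm_inner.
have -> : palm th P Phi (\bigcup_n F n) = \sum_(n <oo) palm th P Phi (F n).
  rewrite palmE//.
  under [RHS]eq_eseriesr do rewrite palmE//.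
  rewrite nneseriesZl; last first.
    by move=> n _; apply: nneseries_ge0 => k _ _; exact: integral_ge0.
  congr *%E; rewrite nneseries_interchange; last first.
    by move=> *; exact: integral_ge0.
  apply: eq_eseriesr => k _.
  rewrite -integral_nneseries//; last by move=> n; exact: measurable_hit.
  apply: eq_integral => w _; rewrite /hit; case: ifP => _; last first.
    by rewrite eseries0.
  under [RHS]eq_eseriesr do rewrite EFinM.
  rewrite nneseriesZl//; rewrite EFinM; congr *%E.
  exact: (measure_semi_bigcup
    (dirac (th (pt Phi k w) w) : {measure set Omega -> \bar R}) mF tF mUF).
by apply: is_cvg_ereal_nneg_natsum => k _.
Qed.

HB.instance Definition _ := isMeasure.Build _ _ _ (palm th P Phi)
  palm0 palm_ge0 palm_sigma_additive.

End palm_measure.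
End flow.
Arguments flow {dO} Omega R d.
Arguments pointProcess {dO} Omega R d.

(* Main.v *)
Require Import Defs.
From HB Require Import structures.
From mathcomp Require Import all_boot all_order all_algebra.
From mathcomp Require Import all_classical all_reals all_analysis.
From mathcomp Require Import measurable_realfun.

Set Implicit Arguments.
Unset Strict Implicit.
Unset Printing Implicit Defensive.

Import Order.TTheory GRing.Theory Num.Theory.
Import numFieldNormedType.Exports.

Local Open Scope classical_set_scope.
Local Open Scope ring_scope.
Local Open Scope ereal_scope.

(** The identity is an instance of the mass transport principle.  Let every
  point X_n of Phi send the mass W (theta_x w) to each point x of Psi attached
  to it, that is, to each x = X_n + Y with Y an atom of Psi_n.  Write
  T(B, C)(w) for the total mass sent from points in B to points in C.

  - Since the marks travel with their points, the picture at theta_u w is the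
    picture at w translated by - u: T(B, C)(theta_u w) = T(B + u, C + u)(w)
    ([transport_flow]).  Hence E T(B, C) = E T(B + u, C + u).
  - Let Q be the half-open unit cell.  Its integer translates Q + z tile the
    space, and T is countably additive in both arguments, so
      E T(Q, R^d) = sum_z E T(Q, Q + z) = sum_z E T(Q - z, Q) = E T(R^d, Q):
    the mean mass sent from Q is the mean mass received in Q
    ([mass_transport]).
  - The mean mass received in Q is lambda_Psi E^0_Psi[W], because the attached
    points make up Psi ([partition_transport]); the mean mass sent from Q is
    lambda_Phi E^0_Phi of the integral of W against the mark of the origin,
    because that mark, seen from theta_{X_n} w, is Psi_n ([mark_origin],
    [palm_transport]).

  Both evaluations rest on Campbell's formula [palm_integral].  The Palm
  probability averages over the closed cube, whereas only half-open cells tile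
  the space; the two averages agree because a stationary process of finite
  intensity has almost surely no point in a face of the cube
  ([mean_measure_unit_boxD]).  The second equality of the theorem is the
  expansion of an integral against a sum of Dirac masses
  ([ge0_integral_atoms]). *)

(** * Integrals against image and restricted measures *)

Section image_measure.
Context d1 d2 (X : measurableType d1) (Y : measurableType d2) (R : realType).
Variables (mu : {measure set X -> \bar R}) (phi : X -> Y).
Hypothesis mphi : measurable_fun setT phi.

(** The image measure bundled with the measurability of the map, which cannot be
  inferred from the map alone. *)
Definition image_measure : {measure set Y -> \bar R} :=
  measure_function_pushforward__canonical__measure_function_Measure mu mphi.

Lemma ge0_integral_image_measure (D : set Y) (f : Y -> \bar R) :
  measurable D -> measurable_fun D f -> (forall y, D y -> 0 <= f y) ->
  \int[image_measure]_(y in D) f y = \int[mu]_(x in phi @^-1` D) f (phi x).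
Proof.
move=> mD mf f0; rewrite ge0_integral_pushforward// => y /[!inE]; exact: f0.
Qed.
End image_measure.

Lemma ge0_integral_mrestr dT (T : measurableType dT) (R : realType)
    (mu : {measure set T -> \bar R}) (D : set T) (mD : measurable D)
    (f : T -> \bar R) :
  measurable_fun setT f -> (forall x, 0 <= f x) ->
  \int[mrestr mu mD]_x f x = \int[mu]_(x in D) f x.
Proof.
move=> mf f0.
have disjDC : [disjoint D & ~` D] by apply/disj_setPS; rewrite setICr.
rewrite -(setUv D) ge0_integral_setU//; [|exact: measurableC|by rewrite setUv].
rewrite (@eq_measure_integral _ _ _ D mu); last first.
  by move=> A mA AD; rewrite /= /mrestr setIidl.
rewrite (@eq_measure_integral _ _ _ (~` D) mzero) ?integral_measure_zero ?adde0//.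
by move=> A mA /disjoints_subset AD; rewrite /= /mrestr AD measure0.
Qed.

(** * Borel sets and lattice cells of the Euclidean space *)

Lemma continuous_addrr (R : realType) (V : normedModType R) (t : V) :
  continuous (fun x : V => x + t)%R.
Proof. by move=> x; apply: cvgD; [exact: cvg_id|exact: cvg_cst]. Qed.

Lemma closed_set1 (R : realType) (V : normedModType R) (x : V) : closed [set x].
Proof. exact/accessible_closed_set1/hausdorff_accessible/norm_hausdorff. Qed.

Section euclidean_space.
Context {R : realType} {d : nat}.
Local Notation Rd := 'rV[R]_d.

Lemma open_measurable_rV (U : set Rd) : open U -> measurable U.
Proof. exact: sub_sigma_algebra. Qed.

Lemma continuous_measurable_rV (f : Rd -> Rd) :
  continuous f -> measurable_fun setT f.
Proof.
move=> cf; apply: (@measurability _ _ _ _ _ _ (@open Rd)) => //.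
move=> _ [U oU <-]; rewrite setTI; apply: open_measurable_rV.
by apply: open_comp => // x _; exact: cf.
Qed.

Lemma measurable_addrr (t : Rd) : measurable_fun setT (fun x : Rd => x + t)%R.
Proof.
by apply: continuous_measurable_rV; exact: continuous_addrr.
Qed.

Lemma measurable_coord (i : 'I_d) : measurable_fun setT (fun x : Rd => x ord0 i).
Proof.
apply: (measurability _ (RGenOpens.measurableE R)) => _ [_ [a [b ->] <-]].
rewrite setTI; apply: open_measurable_rV; apply: open_comp.
  by move=> x _; exact: coord_continuous.
exact: interval_open.
Qed.

Lemma measurable_countable_rV (A : set Rd) : countable A -> measurable A.
Proof.
apply: countable_measurable => x; rewrite -[[set x]]setCK; apply: measurableC.
apply: open_measurable_rV; apply: closed_openC.
exact: closed_set1.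
Qed.

Lemma translateE (B : set Rd) (t : Rd) :
  translate B t = (fun x => x - t)%R @^-1` B.
Proof.
apply/seteqP; split=> [_ [x Bx <-]|x Bx] /=; first by rewrite addrK.
by exists (x - t)%R => //; rewrite subrK.
Qed.

Lemma measurable_translate (B : set Rd) t : measurable B -> measurable (translate B t).
Proof.
move=> mB; rewrite translateE -[X in measurable X]setTI.
exact: measurable_addrr.
Qed.

Definition cell (z : 'rV[int]_d) : set Rd :=
  [set x | forall i, ((z ord0 i)%:~R <= x ord0 i < (z ord0 i + 1)%:~R)%R].

Lemma measurable_cell_preimage dT (T : measurableType dT) (f : T -> Rd) z :
  (forall i, measurable_fun setT (fun w => f w ord0 i)) ->
  measurable (f @^-1` cell z).
Proof.
move=> mf.
have -> : f @^-1` cell z = \bigcap_(i in [set: 'I_d]) ((fun w => f w ord0 i) @^-1`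
    `[(z ord0 i)%:~R, (z ord0 i + 1)%:~R[).
  apply/seteqP; split=> w /= h.
    by move=> i _ /=; rewrite in_itv /=; exact: h.
  by move=> i; have := h i Logic.I; rewrite /= in_itv.
apply: fin_bigcap_measurable => // i _; rewrite -[X in measurable X]setTI.
exact: mf.
Qed.

Lemma measurable_cell z : measurable (cell z).
Proof. by apply: (@measurable_cell_preimage _ _ id) => i; exact: measurable_coord. Qed.

Lemma translate_cell z u :
  translate (cell z) (map_mx intr u) = cell (z + u)%R.
Proof.
rewrite translateE; apply/seteqP; split=> x /= h i; have := h i; rewrite !mxE;
  by rewrite -addrAC !(intrD _ _ (u ord0 i)) lerBrDr ltrBlDr.
Qed.

Lemma cellP x z : cell z x <-> z = map_mx Num.floor x.
Proof.
split=> [h|->]; last by move=> i; rewrite !mxE floor_itv.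
by apply/rowP => i; rewrite !mxE; exact/esym/floor_def/h.
Qed.

(** An enumeration by naturals of the cells [cell (s z)].  For [s] a bijection of
  the lattice it tiles the space; the identity and the opposite list the same
  cells in two orders, so that a sum over z of terms in - z needs no
  reindexing. *)
Definition cells (s : 'rV[int]_d -> 'rV[int]_d) (j : nat) : set Rd :=
  if pickle_inv j is Some z then cell (s z) else set0.

Lemma measurable_cells s j : measurable (cells s j).
Proof. by rewrite /cells; case: pickle_inv => // z; exact: measurable_cell. Qed.

Lemma bigcup_cells s : (forall z, exists u, s u = z) -> \bigcup_j cells s j = setT.
Proof.
move=> ss; apply/seteqP; split=> // x _; have [u su] := ss (map_mx Num.floor x).
by exists (pickle u) => //; rewrite /cells pickleK_inv; exact/cellP.
Qed.

Lemma trivIset_cells s : injective s -> trivIset setT (cells s).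
Proof.
move=> si j k _ _ [x []]; rewrite /cells.
have := @pickle_invK 'rV[int]_d j; have := @pickle_invK 'rV[int]_d k.
case: pickle_inv => //= z <-; case: pickle_inv => //= z' <-.
by move=> /cellP e /cellP; rewrite -e => /si ->.
Qed.
End euclidean_space.

(** * Sums over the points of a configuration *)

Section atoms.
Context {R : realType} {d : nat}.
Local Notation Rd := 'rV[R]_d.

Lemma ge0_integral_atoms (n : option nat) (y : nat -> Rd) (D : set Rd)
    (f : Rd -> \bar R) :
  measurable D -> measurable_fun D f -> (forall x, D x -> 0 <= f x) ->
  \int[atoms n y]_(x in D) f x = \sum_(k <oo | before k n) (f \_ D) (y k).
Proof.
move=> mD mf f0; rewrite ge0_integral_measure_series//.
rewrite [RHS]eseries_mkcond; apply: eq_eseriesr => k _; rewrite /atom.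
case: ifP => _; last exact: integral_measure_zero.
by rewrite integral_dirac// diracE patchE; case: ifP; rewrite ?mul1e ?mul0e.
Qed.

(** Two enumerations of the same configuration give the same sums, for arbitrary
  summands: restricted to the countable set of all points involved, any function
  is measurable, and both sums are its integral against the same measure. *)
Lemma eq_atoms_nneseries (x x' : nat -> Rd) (a : Rd -> \bar R) :
  (forall B, measurable B -> atoms None x B = atoms None x' B) ->
  (forall z, 0 <= a z) ->
  \sum_(n <oo) a (x n) = \sum_(n <oo) a (x' n).
Proof.
move=> xx' a0; pose C := \bigcup_n [set x n; x' n].
have cC (A : set Rd) : A `<=` C -> countable A.
  move=> AC; apply: (@sub_countable _ _ _ C); first exact: subset_card_le.
  by apply: bigcup_countable => // n _; exact: finite_set_countable.
have mC : measurable C by apply: measurable_countable_rV; exact: cC.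
have ma : measurable_fun C a.
  by move=> _ B mB; apply: measurable_countable_rV; apply: cC => z [].
have E (u : nat -> Rd) : range u `<=` C ->
    \int[atoms None u]_(z in C) a z = \sum_(n <oo) a (u n).
  move=> uC; rewrite ge0_integral_atoms//.
  by apply: eq_eseriesr => n _; rewrite patchE ifT// inE; exact: uC.
rewrite -E; last by move=> _ [n _ <-]; exists n => //; left.
rewrite -[RHS]E; last by move=> _ [n _ <-]; exists n => //; right.
by apply: eq_measure_integral => A mA _; exact: xx'.
Qed.

End atoms.

(** * Campbell's formula on a half-open cell *)

Section point_processes.
Context dO (Omega : measurableType dO) (R : realType) (d : nat).
Local Notation Rd := 'rV[R]_d.
Variable th : flow Omega R d.

Lemma measurable_flow_at (x : Omega -> Rd) :
  measurable_fun setT x -> measurable_fun setT (fun w => th (x w) w).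
Proof.
move=> mx; apply: (measurableT_comp (measurable_flow th)
  (g := fun w => (x w, w) : Rd * Omega)).
exact: measurable_fun_pair.
Qed.

Lemma measurable_orbit w : measurable_fun setT (th ^~ w).
Proof.
apply: (measurableT_comp (measurable_flow th) (g := fun x => (x, w) : Rd * Omega)).
exact: measurable_fun_pair.
Qed.

Section stationary.
Variables (P : probability Omega R) (Phi : pointProcess Omega R d).
Hypothesis thP : preserves th P.
Hypothesis Phi_inf : forall w, npts Phi w = None.
Hypothesis Phi_th : compatible th Phi.

Lemma measurable_pt_inf n : measurable_fun setT (pt Phi n).
Proof.
suff -> : [set: Omega] = [set w | before n (npts Phi w)] by exact: measurable_pt.
by apply/seteqP; split=> // w _ /=; rewrite Phi_inf.
Qed.

Lemma measurable_pt_preimage n (B : set Rd) :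
  measurable B -> measurable (pt Phi n @^-1` B).
Proof. by move=> mB; rewrite -[X in measurable X]setTI; exact: measurable_pt_inf. Qed.

Definition mean_measure : {measure set Rd -> \bar R} :=
  mseries (fun n => image_measure P (measurable_pt_inf n)) 0.

Lemma pp_measureE w (B : set Rd) : Phi w B = \sum_(n <oo) (\1_B (pt Phi n w))%:E.
Proof.
rewrite /pp_measure /atoms /= /mseries; apply: eq_eseriesr => n _.
by rewrite /atom Phi_inf /= diracE indicE.
Qed.

Lemma measurable_pp_measure (B : set Rd) :
  measurable B -> measurable_fun setT (fun w => Phi w B).
Proof.
move=> mB; under eq_fun do rewrite pp_measureE.
apply: ge0_emeasurable_sum => [n w _ _|n _]; first by rewrite lee_fin.
apply/measurable_EFinP; apply: (measurableT_comp (f := \1_B : Rd -> R)).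
  exact: measurable_indic.
exact: measurable_pt_inf.
Qed.

Lemma mean_measureE (B : set Rd) :
  measurable B -> mean_measure B = \int[P]_w Phi w B.
Proof.
move=> mB; under eq_integral do rewrite pp_measureE.
rewrite integral_nneseries//; last first.
  move=> n; apply/measurable_EFinP; apply: (measurableT_comp (f := \1_B : Rd -> R)).
    exact: measurable_indic.
  exact: measurable_pt_inf.
apply: eq_eseriesr => n _.
transitivity (\int[P]_w (\1_(pt Phi n @^-1` B) w)%:E).
  by rewrite integral_indic ?setIT//; exact: measurable_pt_preimage.
by apply: eq_integral => w _; rewrite !indicE.
Qed.

Lemma preserves_integral (f : Omega -> \bar R) t :
  measurable_fun setT f -> (forall w, 0 <= f w) ->
  \int[P]_w f (th t w) = \int[P]_w f w.
Proof.
move=> mf f0.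
rewrite -(@ge0_integral_image_measure _ _ _ _ _ P _ (measurable_theta th t) setT)//.
by apply: eq_measure_integral => A mA _; exact: thP.
Qed.

Lemma mean_measure_translate (B : set Rd) t :
  measurable B -> mean_measure (translate B t) = mean_measure B.
Proof.
move=> mB; rewrite !mean_measureE//; last exact: measurable_translate.
under eq_integral do rewrite -Phi_th//.
by apply: (@preserves_integral (fun w => Phi w B)) => //; exact: measurable_pp_measure.
Qed.

Hypothesis intensity_fin : intensity P Phi < +oo.

(* A face of the cube that its half-open part misses. *)
Let top_face (i : 'I_d) : set Rd := unit_box `&` [set x | x ord0 i = 1%R].

Let measurable_top_face i : measurable (top_face i).
Proof.
apply: measurableI; first exact: measurable_unit_box.
rewrite -[X in measurable X]setTI.
by apply: (@measurable_coord R d i measurableT [set 1%R]); exact: measurable_set1.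
Qed.

(* The translates of a face by - e_i / (k + 1) are pairwise disjoint, have the
   same mean number of points, and all lie in the cube, whose mean number of
   points is finite. *)
Let top_face0 i : mean_measure (top_face i) = 0.
Proof.
pose e k : Rd := (- (k.+1%:R^-1 *: delta_mx ord0 i))%R.
pose F k := translate (top_face i) (e k).
have mF k : measurable (F k) by exact: measurable_translate.
have Fi k x : F k x -> x ord0 i = (1 - k.+1%:R^-1)%R.
  rewrite /F translateE /e => -[_] /=; rewrite !mxE !eqxx mulr1 opprK => h.
  by rewrite -[LHS](addrK k.+1%:R^-1%R) h.
have tF : trivIset setT F.
  move=> j k _ _ [x [/Fi Fj /Fi]]; rewrite Fj.
  by move=> /addrI /oppr_inj /invr_inj /eqP; rewrite eqr_nat eqSS => /eqP.
have FQ : \bigcup_k F k `<=` unit_box.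
  move=> x [k _ Fx] j; have [->|ji] := eqVneq j i.
    by rewrite (Fi _ _ Fx) subr_ge0 gerBl invr_ge0 ler0n andbT invf_le1// ler1n.
  move: Fx; rewrite /F translateE /e => -[] /= /(_ j) + _.
  by rewrite !mxE (negbTE ji) andbF mulr0 opprK addr0.
have : mean_measure (\bigcup_k F k) < +oo.
  apply: (@le_lt_trans _ _ (mean_measure unit_box)); last first.
    by rewrite mean_measureE//; exact: measurable_unit_box.
  apply: le_measure => //; rewrite inE; last exact: measurable_unit_box.
  exact: bigcupT_measurable.
rewrite measure_semi_bigcup//; last exact: bigcupT_measurable.
under eq_eseriesr do rewrite mean_measure_translate//.
have : 0 <= mean_measure (top_face i) by exact: measure_ge0.
case: (mean_measure (top_face i)) => [c||//]; last first.
  by rewrite (nneseries_pinfty (k := 0%N))// => n _.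
rewrite lee_fin le_eqVlt => /predU1P[<-//|c0].
have S0 : 0 <= \sum_(k <oo) c%:E by apply: nneseries_ge0 => k _ _; rewrite lee_fin ltW.
move: S0 (fun n => @nneseries_lim_ge R (fun=> c%:E) xpredT 0 n (fun _ _ _ => ltW c0)).
case: (\sum_(k <oo) c%:E) => // M _ partial _.
have := partial (Num.truncn (M / c)).+1.
rewrite sumEFin big_const_nat iter_addr_0 subn0 lee_fin -mulr_natl -ler_pdivlMr//.
by rewrite leNgt truncnS_gt.
Qed.

Let cell0_unit_box : (cell 0 : set Rd) `<=` unit_box.
Proof. by move=> x h i; have := h i; rewrite !mxE => /andP[-> /ltW]. Qed.

(** The mean measure does not distinguish the closed cube from its half-open
  part, since it is translation invariant and finite on the cube. *)
Lemma mean_measure_unit_boxD : mean_measure (unit_box `\` cell 0) = 0.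
Proof.
apply/eqP; rewrite eq_le measure_ge0 andbT.
have fin : finite_set [set: 'I_d] by exact: finite_finset.
apply: (@le_trans _ _ (\sum_(i \in [set: 'I_d]) mean_measure (top_face i))%R);
  last by rewrite fsbig1.
apply: (content_sub_fsum mean_measure fin) => //.
- by apply: measurableD; [exact: measurable_unit_box|exact: measurable_cell].
- move=> x [Qx] /existsNP[i /negP]; rewrite !mxE => xi; exists i => //; split => //=.
  have /andP[x0 x1] := Qx i; apply/eqP; rewrite eq_le x1/=.
  by move: xi; rewrite x0 /= -leNgt.
Qed.


Hypothesis intensity_gt0 : 0 < intensity P Phi.

Lemma probability_pt_unit_box n (A : set Omega) : measurable A ->
  P (A `&` pt Phi n @^-1` unit_box) = P (A `&` pt Phi n @^-1` cell 0).
Proof.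
move=> mA.
have mb := measurable_pt_preimage n (@measurable_unit_box R d).
have mc := measurable_pt_preimage n (@measurable_cell R d 0).
have P0 : P (pt Phi n @^-1` (unit_box `\` cell 0)) = 0.
  apply/eqP; rewrite eq_le measure_ge0 andbT -mean_measure_unit_boxD.
  rewrite /mean_measure /= /mseries.
  apply: le_trans (nneseries_lim_ge n.+1 _); last by move=> k _ _; exact: measure_ge0.
  rewrite big_nat_recr//= leeDr// sume_ge0// => k _.
  exact: (measure_ge0 P).
have cb : pt Phi n @^-1` cell 0 `<=` pt Phi n @^-1` unit_box.
  by move=> w; exact: cell0_unit_box.
have mAb := measurableI _ _ mA mb; have mAc := measurableI _ _ mA mc.
have mD := measurableD mb mc.
apply/eqP; rewrite eq_le; apply/andP; split; last first.
  by apply: (le_measure P); rewrite ?inE//; exact: setIS.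
rewrite -[leRHS]adde0 -P0; apply: le_trans (measureU2 P mAc mD).
apply: (le_measure P); rewrite ?inE//; first exact: measurableU.
move=> w [Aw bw]; have [cw|ncw] := pselect (cell 0 (pt Phi n w)); first by left.
by right.
Qed.

Lemma measurable_theta_pt n : measurable_fun setT (fun w => th (pt Phi n w) w).
Proof. exact/measurable_flow_at/measurable_pt_inf. Qed.

(** The measure E [sum_n 1_Q(X_n) 1_A(theta_{X_n})] in A, with Q the half-open
  cell; written as a sum of image measures, it can be integrated against term by
  term. *)
Definition campbell_measure : {measure set Omega -> \bar R} :=
  mseries (fun n => image_measure
    (mrestr P (measurable_pt_preimage n (@measurable_cell R d 0)))
    (measurable_theta_pt n)) 0.

Lemma palmE (A : set Omega) : measurable A ->
  intensity P Phi * palm th P Phi A = campbell_measure A.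
Proof.
move=> mA; rewrite /palm muleA.
have -> : intensity P Phi * ((fine (intensity P Phi))^-1)%:E = 1.
  move: intensity_fin intensity_gt0; case: (intensity P Phi) => //= r _.
  by rewrite lte_fin => r0; rewrite -EFinM divff// gt_eqF.
rewrite mul1e.
pose E n := (fun w => th (pt Phi n w) w) @^-1` A.
have mE n : measurable (E n).
  by rewrite -[X in measurable X]setTI; exact: measurable_theta_pt.
pose b n := pt Phi n @^-1` unit_box.
have mb n : measurable (b n) := measurable_pt_preimage n (@measurable_unit_box R d).
transitivity (\int[P]_w \sum_(n <oo) (\1_(E n `&` b n) w)%:E).
  apply: eq_integral => w _; rewrite ge0_integral_atoms//; last 2 first.
  - exact: measurable_unit_box.
  - apply/measurable_EFinP; apply: measurable_funTS.
    apply: (measurableT_comp (f := \1_A : Omega -> R)); first exact: measurable_indic.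
    exact: measurable_orbit.
  rewrite Phi_inf; apply: eq_eseriesr => n _.
  rewrite patchE indicI /= !indicE; case: ifP => bw.
    by rewrite (bw : (w \in b n) = _) mulr1.
  by rewrite (bw : (w \in b n) = _) mulr0.
rewrite integral_nneseries//; last first.
  by move=> n; apply/measurable_EFinP/measurable_indic; exact: measurableI.
apply: eq_eseriesr => n _; rewrite integral_indic ?setIT//; last exact: measurableI.
exact: probability_pt_unit_box.
Qed.

(** Campbell's formula.  Both sides are integrals of [F] against the single
  measure [campbell_measure], by [palmE] on the left and term by term on the
  right. *)
Lemma palm_integral (F : Omega -> \bar R) :
  measurable_fun setT F -> (forall w, 0 <= F w) ->
  intensity P Phi * \int[palm th P Phi]_w F w =
  \int[P]_w \int[Phi w]_(x in cell 0) F (th x w).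
Proof.
move=> mF F0.
have mFt n : measurable_fun setT (fun w => F (th (pt Phi n w) w)).
  by apply: (measurableT_comp mF); exact: measurable_theta_pt.
have m0 n := measurable_pt_preimage n (@measurable_cell R d 0).
transitivity (\int[campbell_measure]_w F w).
  have r0 : (0 <= fine (intensity P Phi))%R by rewrite fine_ge0// ltW.
  have intE : intensity P Phi = (NngNum r0)%:num%:E.
    by rewrite /= fineK// gt0_fin_numE.
  rewrite [X in X * _]intE -ge0_integral_mscale//.
  apply: eq_measure_integral => A mA _.
  by rewrite -palmE// [X in _ = X * _]intE.
transitivity (\int[P]_w \sum_(n <oo)
    ((fun w => F (th (pt Phi n w) w)) \_ (pt Phi n @^-1` cell 0)) w).
  rewrite ge0_integral_measure_series// integral_nneseries//; last 2 first.
  - move=> n; apply: (measurable_restrictT _ (m0 n)).1.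
    exact: measurable_funTS.
  - by move=> n w _; rewrite patchE; case: ifP.
  apply: eq_eseriesr => n _; rewrite -integral_mkcond.
  by rewrite ge0_integral_image_measure// preimage_setT ge0_integral_mrestr.
apply: eq_integral => w _; rewrite ge0_integral_atoms//; last 2 first.
- exact: measurable_cell.
- by apply: measurable_funTS; exact: measurableT_comp mF (measurable_orbit w).
by rewrite Phi_inf; apply: eq_eseriesr.
Qed.

End stationary.

(** * The mark of the origin *)

Section marks.
Variables (P : probability Omega R) (Phi : pointProcess Omega R d).
Variables (mark : nat -> pointProcess Omega R d) (g : Omega -> \bar R).
Hypothesis thP : preserves th P.
Hypothesis Phi_inf : forall w, npts Phi w = None.
Hypothesis Phi_mark : compatible_marks th Phi mark.
Hypothesis mg : measurable_fun setT g.
Hypothesis g_ge0 : forall w, 0 <= g w.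

Let Phi_th : compatible th Phi. Proof. by case: Phi_mark. Qed.

Let g_orbit_measurable w : measurable_fun setT (fun x => g (th x w)).
Proof. exact: measurableT_comp mg (measurable_orbit w). Qed.

Let eq_mark t w n n' (B : set Rd) : measurable B ->
  pt Phi n (th t w) = (pt Phi n' w - t)%R ->
  mark n (th t w) B = mark n' w B.
Proof. by move=> mB e; case: Phi_mark => _; apply; rewrite ?Phi_inf. Qed.

(** The flow by X_n moves the n-th point to the origin, and its mark with it.  When
  several points sit at the origin any index found there will do, since
  compatibility relates the mark of each of them to Psi_n. *)
Lemma mark_origin n w (B : set Rd) : measurable B ->
  let w' := th (pt Phi n w) w in mark (origin_index Phi w') w' B = mark n w B.
Proof.
move=> mB w'; apply: eq_mark => //; rewrite subrr -/w'.
suff ex : exists i, before i (npts Phi w') /\ pt Phi i w' = 0%R.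
  by have [] := xgetPex 0%N ex.
apply: contrapT => /forallNP nex.
have m0 : measurable [set 0%R : Rd] by exact: measurable_countable_rV.
have := Phi_th w (pt Phi n w) m0; rewrite -/w' !pp_measureE// eseries0; last first.
  move=> i _ _; rewrite indicE memNset// => e.
  by apply: (nex i); rewrite Phi_inf; split.
rewrite (nneseriesD1 (n := n))//.
rewrite translateE indicE mem_set/= ?subrr// => /esym/eqP.
rewrite padde_eq0 ?onee_eq0//.
by apply: nneseries_ge0 => k _ _; rewrite lee_fin.
Qed.

Definition mark_integral (w : Omega) : \bar R :=
  \int[mark (origin_index Phi w) w]_y g (th y w).

(** Attached points are sums y + x of random vectors, which are measurable
  coordinate by coordinate; a cell, being cut out by finitely many constraints
  on coordinates, has this property. *)
Definition coord_measurable (C : set Rd) := forall x : Omega -> Rd,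
  (forall i, measurable_fun setT (fun w => x w ord0 i)) -> measurable (x @^-1` C).

Lemma measurable_mark_sum n (x : Omega -> Rd) (C : set Rd) :
  coord_measurable C -> measurable_fun setT x ->
  measurable_fun setT (fun w => \sum_(k <oo | before k (npts (mark n) w))
    ((fun y => g (th (y + x w)%R w)) \_ ((fun y => y + x w)%R @^-1` C))
      (pt (mark n) k w)).
Proof.
move=> mC mx.
(* a point of a mark is measurable only where it exists; extend it by 0 *)
pose y k w := if before k (npts (mark n) w) then pt (mark n) k w else 0%R.
have mb k : measurable_fun setT (fun w => before k (npts (mark n) w)).
  by apply: (measurable_fun_bool true); rewrite setTI; exact: measurable_npts.
have my k : measurable_fun setT (y k).
  by apply: measurable_fun_if => //; rewrite setTI; exact: measurable_pt.
rewrite (_ : (fun w => _) = (fun w => \sum_(k <oo)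
    if before k (npts (mark n) w) then
      if (y k w + x w)%R \in C then g (th (y k w + x w)%R w) else 0 else 0)).
  apply: ge0_emeasurable_sum => [k w _ _|k _]; first by case: ifP => // _; case: ifP.
  apply: measurable_fun_ifT => //; apply: measurable_fun_ifT => //.
    apply: (measurable_fun_bool true); rewrite setTI.
    rewrite (_ : _ @^-1` _ = (fun w => y k w + x w)%R @^-1` C); last first.
      by apply/seteqP; split=> w /= => [/set_mem|/mem_set].
    apply: mC => i; under eq_fun do rewrite mxE.
    by apply: measurable_funD; apply: (measurableT_comp (measurable_coord i)).
  (* the flow is jointly measurable, so move by x first and by y second *)
  under eq_fun do rewrite -thetaD.
  apply: (measurableT_comp mg).
  apply: (measurableT_comp (measurable_flow th)
    (g := fun w => (y k w, th (x w) w) : Rd * Omega)).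
  by apply: measurable_fun_pair => //; exact: measurable_flow_at.
apply/funext => w; rewrite eseries_mkcond; apply: eq_eseriesr => k _.
by rewrite /y; case: ifP => // _; rewrite patchE.
Qed.

Let mark_integral_at0 n w : pt Phi n w = 0%R ->
  mark_integral w = \int[mark n w]_y g (th y w).
Proof.
move=> pt0; apply: eq_measure_integral => B mB _.
have ex : exists i, before i (npts Phi w) /\ pt Phi i w = 0%R.
  by exists n; rewrite Phi_inf.
have [_ o0] := xgetPex 0%N ex.
have := @eq_mark 0%R w (origin_index Phi w) n B mB.
by rewrite theta0 subr0 pt0; apply.
Qed.

(** Points that coincide at the origin carry equal marks, so on each event
  {X_n = 0} the integral is the one against the n-th mark, whichever index stands
  for the origin; countably many such measurable pieces make up the function. *)
Lemma measurable_mark_integral : measurable_fun setT mark_integral.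
Proof.
pose I n w := \int[mark n w]_y g (th y w).
have mI n : measurable_fun setT (I n).
  rewrite (_ : I n = fun w => \sum_(k <oo | before k (npts (mark n) w))
      ((fun y => g (th (y + cst 0 w)%R w)) \_ ((fun y => y + cst 0 w)%R @^-1` setT))
      (pt (mark n) k w)).
    apply: (@measurable_mark_sum n (cst 0%R) setT) => //.
    by move=> x _; rewrite preimage_setT.
  apply/funext => w; rewrite /I ge0_integral_atoms//.
  apply: eq_eseriesr => k _; rewrite preimage_setT !patch_setT /=.
  by rewrite addr0.
move=> _ B mB; rewrite setTI.
have m0 : measurable [set 0%R : Rd] by exact: measurable_countable_rV.
have mpt n := measurable_pt_preimage Phi_inf n m0.
have mIB n : measurable (I n @^-1` B).
  by rewrite -[X in measurable X]setTI; exact: mI.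
rewrite (_ : _ @^-1` B =
    \bigcup_n (pt Phi n @^-1` [set 0%R] `&` I n @^-1` B) `|`
    (\bigcap_n ~` (pt Phi n @^-1` [set 0%R]) `&` I 0%N @^-1` B)).
  apply: measurableU; first by apply: bigcupT_measurable => n; exact: measurableI.
  by apply: measurableI => //; apply: bigcapT_measurable => n; exact: measurableC.
apply/seteqP; split=> w /=.
  move=> Bw; have [[n pt0]|no0] := pselect (exists n, pt Phi n w = 0%R).
    by left; exists n => //; split; rewrite // /= /I -(mark_integral_at0 pt0).
  right; split; first by move=> n _ pt0; apply: no0; exists n.
  move: Bw; rewrite /mark_integral /origin_index xgetPN// => i [_ pt0].
  by apply: no0; exists i.
move=> [[n _ [/= pt0 Bw]]|[no0 Bw]]; first by rewrite (mark_integral_at0 pt0).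
rewrite /mark_integral /origin_index xgetPN// => i [_ pt0].
exact: no0 pt0.
Qed.

(** * Mass transport *)

(** S_{-X_n} Psi_n, encoded as an image measure so that integrals against it pull
  back to the mark. *)
Definition attached n w : {measure set Rd -> \bar R} :=
  image_measure (mark n w) (measurable_addrr (pt Phi n w)).

(** The mass T(B, C) sent from [B] to [C]. *)
Definition transport (B C : set Rd) (w : Omega) : \bar R :=
  \sum_(n <oo) (\1_B (pt Phi n w))%:E * \int[attached n w]_(x in C) g (th x w).

Lemma integral_attached n w (C : set Rd) : measurable C ->
  \int[attached n w]_(x in C) g (th x w) =
  \int[mark n w]_(y in (fun y => y + pt Phi n w)%R @^-1` C)
    g (th (y + pt Phi n w)%R w).
Proof.
by move=> mC; rewrite ge0_integral_image_measure//; exact: measurable_funTS.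
Qed.

Lemma transport_ge0 B C w : 0 <= transport B C w.
Proof.
apply: nneseries_ge0 => n _ _; apply: mule_ge0; first by rewrite lee_fin.
exact: integral_ge0.
Qed.

Lemma measurable_integral_attached n (C : set Rd) :
  measurable C -> coord_measurable C ->
  measurable_fun setT (fun w => \int[attached n w]_(x in C) g (th x w)).
Proof.
move=> mC cC; under eq_fun do rewrite integral_attached//.
under eq_fun => w.
  rewrite ge0_integral_atoms//; last 2 first.
    by rewrite -[X in measurable X]setTI; exact: measurable_addrr.
    apply: measurable_funTS.
    by apply: (measurableT_comp (g_orbit_measurable w)); exact: measurable_addrr.
  over.
by apply: measurable_mark_sum => //; exact: measurable_pt_inf.
Qed.

Lemma measurable_transport (B C : set Rd) :
  measurable B -> measurable C -> coord_measurable C ->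
  measurable_fun setT (transport B C).
Proof.
move=> mB mC cC; apply: ge0_emeasurable_sum => [n w _ _|n _].
  by apply: mule_ge0; [rewrite lee_fin|exact: integral_ge0].
apply: emeasurable_funM; last exact: measurable_integral_attached.
apply/measurable_EFinP; apply: (measurableT_comp (f := \1_B : Rd -> R)).
  exact: measurable_indic.
exact: measurable_pt_inf.
Qed.

(* What a point at x sends into C, expressed in the configuration seen from that
   point: it depends on x and on the configuration, but not on the index of the
   point. *)
Let origin_integral (C : set Rd) (x : Rd) (w : Omega) : \bar R :=
  \int[mark (origin_index Phi w) w]_(y in (fun y => y + x)%R @^-1` C) g (th y w).

Let integral_attachedE n w (C : set Rd) : measurable C ->
  \int[attached n w]_(x in C) g (th x w) =
  origin_integral C (pt Phi n w) (th (pt Phi n w) w).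
Proof.
move=> mC; rewrite integral_attached// /origin_integral.
under [RHS]eq_integral do rewrite -[th _ (th _ _)]/((th _ \o th _) w) thetaD.
by apply/esym/eq_measure_integral => B mB _; exact: mark_origin.
Qed.

(** The mass sent by a point is a function of its position and of the
  configuration seen from it, so the sum over the points of [Phi] at theta_u w
  is a sum over the points of [Phi] at [w] shifted by - u. *)
Lemma transport_flow (B C : set Rd) u w : measurable C ->
  transport B C (th u w) = transport (translate B u) (translate C u) w.
Proof.
move=> mC; pose a x := (\1_B x)%:E * origin_integral C x (th x (th u w)).
transitivity (\sum_(n <oo) a (pt Phi n (th u w))).
  by apply: eq_eseriesr => n _; rewrite integral_attachedE.
rewrite (@eq_atoms_nneseries _ _ _ (fun n => pt Phi n w - u)%R).
- apply: eq_eseriesr => n _; rewrite integral_attachedE; last exact: measurable_translate.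
  rewrite /a /origin_integral !translateE -[th (_ - u)%R _]/((th _ \o th u) w) thetaD subrK.
  congr (_ * integral _ _ _).
  by apply/seteqP; split=> y /=; rewrite addrA.
- move=> D mD; have := Phi_th w u mD; rewrite /pp_measure !Phi_inf => ->.
  by apply: eq_eseriesr => n _; rewrite /atom/= !diracE translateE.
- by move=> z; apply: mule_ge0; [rewrite lee_fin|exact: integral_ge0].
Qed.

Lemma transport_bigcupr (B : set Rd) (F : (set Rd)^nat) w :
  (forall j, measurable (F j)) -> trivIset setT F ->
  \sum_(j <oo) transport B (F j) w = transport B (\bigcup_j F j) w.
Proof.
move=> mF tF; rewrite nneseries_interchange; last first.
  by move=> j n; apply: mule_ge0; [rewrite lee_fin|exact: integral_ge0].
apply: eq_eseriesr => n _; rewrite nneseriesZl; last first.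
  by move=> j _; exact: integral_ge0.
by rewrite ge0_integral_bigcup//; exact: measurable_funTS.
Qed.

Lemma transport_bigcupl (F : (set Rd)^nat) (C : set Rd) w :
  (forall j, measurable (F j)) -> trivIset setT F ->
  \sum_(j <oo) transport (F j) C w = transport (\bigcup_j F j) C w.
Proof.
move=> mF tF; rewrite nneseries_interchange; last first.
  by move=> j n; apply: mule_ge0; [rewrite lee_fin|exact: integral_ge0].
apply: eq_eseriesr => n _; set c := \int[_]_(x in C) _.
have c0 : 0 <= c by exact: integral_ge0.
(* c may be infinite, so additivity is that of an integral, not of a multiple *)
have diracE (D : set Rd) : measurable D ->
    (\1_D (pt Phi n w))%:E * c = \int[\d_(pt Phi n w)]_(x in D) cst c x.
  by move=> mD; rewrite integral_dirac.
under eq_eseriesr do rewrite diracE//.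
rewrite diracE; last exact: bigcupT_measurable.
by rewrite ge0_integral_bigcup.
Qed.

(** The mean mass sent from the unit cell is the mean mass received in it: tile
  the receiving side, shift each term back by the flow, and collect the tiles on
  the sending side. *)
Lemma mass_transport :
  \int[P]_w transport (cell 0) setT w = \int[P]_w transport setT (cell 0) w.
Proof.
have coord_cell z : coord_measurable (cell z).
  by move=> x; exact: measurable_cell_preimage.
have coord_cells s j : coord_measurable (cells s j).
  by rewrite /cells; case: pickle_inv => //= x _; rewrite preimage_set0.
have mC := @measurable_cell R d.
transitivity (\sum_(j <oo) \int[P]_w transport (cell 0) (cells id j) w).
  rewrite -integral_nneseries//; last 2 first.
  - move=> j; apply: measurable_transport => //; exact: measurable_cells.
  - by move=> j w _; exact: transport_ge0.
  apply: eq_integral => w _; rewrite transport_bigcupr.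
  - by rewrite bigcup_cells// => z; exists z.
  - by move=> j; exact: measurable_cells.
  - exact: trivIset_cells.
transitivity (\sum_(j <oo) \int[P]_w transport (cells -%R j) (cell 0) w); last first.
  rewrite -integral_nneseries//; last 2 first.
  - move=> j; apply: measurable_transport => //; exact: measurable_cells.
  - by move=> j w _; exact: transport_ge0.
  apply: eq_integral => w _; rewrite transport_bigcupl.
  - by rewrite bigcup_cells// => z; exists (- z)%R; rewrite opprK.
  - by move=> j; exact: measurable_cells.
  - exact/trivIset_cells/oppr_inj.
(* shifting by - z takes (Q, Q + z) to (Q - z, Q) *)
apply: eq_eseriesr => j _; rewrite /cells; case: pickle_inv => [z|].
  rewrite -(@preserves_integral P thP _ (map_mx intr (- z))); last 2 first.
  - exact: measurable_transport.
  - by move=> w; exact: transport_ge0.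
  apply: eq_integral => w _; rewrite transport_flow// !translate_cell.
  by rewrite add0r addrN.
rewrite /transport; apply: eq_integral => w _; rewrite !eseries0// => n _ _.
  by rewrite indic0 mul0e.
by rewrite integral_set0 mule0.
Qed.

Lemma palm_transport : 0 < intensity P Phi < +oo ->
  intensity P Phi * \int[palm th P Phi]_w mark_integral w =
  \int[P]_w transport (cell 0) setT w.
Proof.
move=> /andP[i0 ioo].
have mm := measurable_mark_integral.
have m0 w : 0 <= mark_integral w by exact: integral_ge0.
rewrite (palm_integral thP Phi_inf)//.
apply: eq_integral => w _; rewrite ge0_integral_atoms//; last 2 first.
- exact: measurable_cell.
- by apply: measurable_funTS; exact: measurableT_comp mm (measurable_orbit w).
rewrite Phi_inf; apply: eq_eseriesr => n _.
rewrite integral_attachedE// patchE indicE; case: ifP => _; last by rewrite mul0e.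
by rewrite mul1e /origin_integral preimage_setT.
Qed.

Lemma partition_transport (Psi : pointProcess Omega R d) w (C : set Rd) :
  (forall B, measurable B ->
    Psi w B = \sum_(n <oo) shift_measure (- pt Phi n w)%R (mark n w) B) ->
  measurable C ->
  \int[Psi w]_(x in C) g (th x w) = transport setT C w.
Proof.
move=> partition mC.
rewrite (@eq_measure_integral _ _ _ C (mseries (attached ^~ w) 0)); last first.
  move=> B mB _; rewrite partition//; apply: eq_eseriesr => n _.
  by rewrite /shift_measure translateE opprK.
rewrite ge0_integral_measure_series//; last exact: measurable_funTS.
by apply: eq_eseriesr => n _; rewrite indicT mul1e.
Qed.

End marks.

End point_processes.

(** * The Palm transport formula *)

Theorem theorem1 (dO : measure_display) (Omega : measurableType dO)
    (R : realType) (d : nat) (P : probability Omega R)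
    (th : flow Omega R d) (Phi Psi : pointProcess Omega R d)
    (mark : nat -> pointProcess Omega R d) :
  preserves th P ->
  (forall w, npts Phi w = None) ->
  (forall w, npts Psi w = None) ->
  simple P Phi -> simple P Psi ->
  compatible th Phi -> compatible th Psi ->
  0 < intensity P Phi < +oo ->
  0 < intensity P Psi < +oo ->
  (forall w B, measurable B ->
    Psi w B = \sum_(n <oo) shift_measure (- pt Phi n w)%R (mark n w) B) ->
  compatible_marks th Phi mark ->
  forall W : {RV P >-> R}, (forall w, (0 <= W w)%R) ->
  intensity P Psi * \int[palm th P Psi]_w (W w)%:E =
    intensity P Phi * \int[palm th P Phi]_w
      \int[mark (origin_index Phi w) w]_y (W (th y w))%:E
  /\
  intensity P Phi * \int[palm th P Phi]_w
      \int[mark (origin_index Phi w) w]_y (W (th y w))%:E =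
    intensity P Phi * \int[palm th P Phi]_w
      \sum_(k <oo | before k (npts (mark (origin_index Phi w)) w))
        (W (th (pt (mark (origin_index Phi w)) k w) w))%:E.
Proof.
move=> thP Phi_inf Psi_inf _ _ _ Psi_th Phi_int Psi_int partition Phi_mark W W0.
pose g w := (W w)%:E.
have mg : measurable_fun setT g by apply/measurable_EFinP; exact: measurable_funP.
have g0 w : 0 <= g w by rewrite lee_fin.
split.
  have /andP[Psi_gt0 Psi_fin] := Psi_int.
  rewrite (palm_integral thP Psi_inf Psi_th Psi_fin Psi_gt0 mg g0).
  rewrite [RHS](palm_transport thP Phi_inf Phi_mark mg g0 Phi_int).
  rewrite (mass_transport thP Phi_inf Phi_mark mg g0).
  apply: eq_integral => w _.
  by rewrite (partition_transport th mg g0 (partition w))//; exact: measurable_cell.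
congr *%E; apply: eq_integral => w _; rewrite ge0_integral_atoms//; last 2 first.
- exact: measurableT_comp mg (measurable_orbit th w).
- by move=> x _; exact: g0.
by apply: eq_eseriesr => k _; rewrite patch_setT.
Qed.
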